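(* Fix $p\in(0,1)$. For each $n$, let $\{X^n_t\}_{t=0}^\infty$ be the overhand shuffle with parameter $p$ on a deck of $n$ cards, started from a fixed ordering of the deck, and let $U^n$ be the uniform distribution on the set $S_n$ of orderings of the $n$ cards. Then $$f(n)=\frac{p^2(2-p)}{8\pi^2(1-p^2)}\,n^2\log n$$ is a lower bound for the mixing time of this sequence of Markov chains, i.e. $$\lim_{n\to\infty}\big\|P\big(X^n_{\lfloor f(n)\rfloor}\in\cdot\big)-U^n\big\|=1 .$$
   Context: The overhand shuffle with parameter $p\in(0,1)$ is the Markov chain on the set $S_n$ of orderings of $n$ cards in positions $1,\dots,n$ with the following transition rule. At each step, each of the $n-1$ slots between adjacent positions is, independently of the other slots and of the past, declared a cutpoint with probability $p$. The cutpoints divide the deck into consecutive packets of cards (maximal blocks of consecutive positions with no cutpoint inside). Each packet is then reversed in place, that is, the order of the cards within each packet is reversed without changing the position of the packet relative to the other packets. The deck is linear: the top and bottom cards are not regarded as adjacent. For probability measures $\mu,\nu$ on a finite set $S$, $\|\mu-\nu\|=\tfrac12\sum_{s\in S}|\mu(s)-\nu(s)|$ is the total variation norm. A sequence $f(n)$ is called a lower bound for the mixing time of a sequence of Markov chains $\{X^n_t\}$ with stationary distributions $\pi^n$ if $\lim_{n\to\infty}\|P(X^n_{f(n)}\in\cdot)-\pi^n\|=1$. Here the stationary distribution is the uniform distribution $U^n$ on $S_n$, and $\log$ is the natural logarithm. *)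

(* Defs.v *)
From HB Require Import structures.
From mathcomp Require Import all_boot all_order all_algebra all_fingroup.
From mathcomp Require Import all_classical all_reals all_analysis.
From mathcomp Require Import zify.
Set Implicit Arguments.
Unset Strict Implicit.
Unset Printing Implicit Defensive.
Import Order.TTheory GRing.Theory Num.Theory.
Import numFieldNormedType.Exports.

Local Open Scope classical_set_scope.
Local Open Scope ring_scope.

(* A deck of n cards is a permutation s : 'S_n, with s i the card in position
   i; positions and cards are numbered from 0.  The slot k : 'I_n.-1 lies
   between the positions k and k.+1, and c : {set 'I_n.-1} is a set of
   cutpoints. *)

Section Packets.
Variables (n : nat) (c : {set 'I_n.-1}).
Local Open Scope nat_scope.

Definition same_packet (i j : 'I_n) : bool :=
  [forall k in c, ~~ (minn i j <= k < maxn i j)].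

Definition packet_first (i : 'I_n) : 'I_n :=
  [arg min_(j < i | same_packet i j) (j : nat)].

Definition packet_last (i : 'I_n) : 'I_n :=
  [arg max_(j > i | same_packet i j) (j : nat)].

Lemma same_packet_refl i : same_packet i i.
Proof. by apply/forall_inP => k _; rewrite minnn maxnn; lia. Qed.

Lemma same_packet_sym i j : same_packet i j = same_packet j i.
Proof. by rewrite /same_packet minnC maxnC. Qed.

Lemma same_packet_trans i j l :
  same_packet i j -> same_packet j l -> same_packet i l.
Proof.
move=> /forall_inP ij /forall_inP jl; apply/forall_inP => k kc.
by have := ij k kc; have := jl k kc; lia.
Qed.

Lemma same_packet_between i j l (m : 'I_n) :
  same_packet i j -> same_packet i l -> j <= m <= l -> same_packet i m.
Proof.
move=> /forall_inP ij /forall_inP il jml; apply/forall_inP => k kc.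
by have := ij k kc; have := il k kc; lia.
Qed.

Lemma packet_firstP i :
  same_packet i (packet_first i) /\
  forall j, same_packet i j -> packet_first i <= j.
Proof.
by rewrite /packet_first; case: arg_minnP => //; exact: same_packet_refl.
Qed.

Lemma packet_lastP i :
  same_packet i (packet_last i) /\
  forall j, same_packet i j -> j <= packet_last i.
Proof.
by rewrite /packet_last; case: arg_maxnP => //; exact: same_packet_refl.
Qed.

Lemma packet_reflect_subproof i : packet_first i + packet_last i - i < n.
Proof.
have [_ /(_ i (same_packet_refl i)) fi] := packet_firstP i.
by have := ltn_ord (packet_last i); lia.
Qed.

Definition packet_reflect (i : 'I_n) : 'I_n :=
  Ordinal (packet_reflect_subproof i).

Lemma same_packet_reflect i : same_packet i (packet_reflect i).
Proof.
have [sf fm] := packet_firstP i; have [sl lm] := packet_lastP i.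
have := fm _ (same_packet_refl i); have := lm _ (same_packet_refl i).
by move=> il fi; apply: (same_packet_between sf sl) => /=; lia.
Qed.

Lemma packet_first_eq i j :
  same_packet i j -> packet_first i = packet_first j.
Proof.
move=> ij; have ji : same_packet j i by rewrite same_packet_sym.
have [si mi] := packet_firstP i; have [sj mj] := packet_firstP j.
apply/val_inj/eqP; rewrite eqn_leq.
by rewrite (mi _ (same_packet_trans ij sj)) (mj _ (same_packet_trans ji si)).
Qed.

Lemma packet_last_eq i j : same_packet i j -> packet_last i = packet_last j.
Proof.
move=> ij; have ji : same_packet j i by rewrite same_packet_sym.
have [si mi] := packet_lastP i; have [sj mj] := packet_lastP j.
apply/val_inj/eqP; rewrite eqn_leq.
by rewrite (mj _ (same_packet_trans ji si)) (mi _ (same_packet_trans ij sj)).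
Qed.

Lemma packet_reflectK : involutive packet_reflect.
Proof.
move=> i; apply/val_inj => /=; have si := same_packet_reflect i.
rewrite -(packet_first_eq si) -(packet_last_eq si).
have [_ /(_ i (same_packet_refl i)) fi] := packet_firstP i.
have [_ /(_ i (same_packet_refl i)) il] := packet_lastP i.
lia.
Qed.

Definition reverse_packets (s : 'S_n) : 'S_n :=
  (perm (inv_inj packet_reflectK) * s)%g.

Lemma reverse_packetsE (s : 'S_n) (i : 'I_n) :
  reverse_packets s i = s (packet_reflect i).
Proof. by rewrite permM permE. Qed.

End Packets.

Definition cut_prob (R : realType) (p : R) (n : nat) (c : {set 'I_n.-1}) : R :=
  \prod_(k < n.-1) (if k \in c then p else 1 - p).

Definition overhand (R : realType) (p : R) (n : nat) (s s' : 'S_n) : R :=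
  \sum_(c : {set 'I_n.-1} | reverse_packets c s == s') cut_prob p c.

(* The Markov property is stated without conditional probabilities, so that
   paths of probability 0 need no separate treatment; x is only used up to
   time t.+1. *)
Definition markov_chain (R : realType) (d : measure_display)
    (T : measurableType d) (P : probability T R) (S : finType)
    (K : S -> S -> R) (x0 : S) (X : nat -> T -> S) : Prop :=
  [/\ forall t s, measurable [set w | X t w = s],
      P [set w | X 0%N w = x0] = 1%E
    & forall (t : nat) (x : nat -> S),
        P [set w | forall i, (i <= t.+1)%N -> X i w = x i] =
        (P [set w | forall i, (i <= t)%N -> X i w = x i]
         * (K (x t) (x t.+1))%:E)%E].

Definition law (R : realType) (d : measure_display) (T : measurableType d)
    (P : probability T R) (S : finType) (Y : T -> S) (s : S) : R :=
  fine (P [set w | Y w = s]).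

Definition uniform_law (R : realType) (S : finType) (s : S) : R := #|S|%:R^-1.

(* Measures on the finite set S are given by their values on singletons. *)
Definition tv_norm (R : realType) (S : finType) (mu nu : S -> R) : R :=
  2^-1 * \sum_(s : S) `|mu s - nu s|.

(* Main.v *)
Require Import Defs.
From HB Require Import structures.
From mathcomp Require Import all_boot all_order all_algebra all_fingroup.
From mathcomp Require Import all_classical all_reals all_analysis.
From mathcomp Require Import zify ring lra.
Set Implicit Arguments.
Unset Strict Implicit.
Unset Printing Implicit Defensive.
Import Order.TTheory GRing.Theory Num.Theory.
Import numFieldNormedType.Exports.
Local Open Scope classical_set_scope.
Local Open Scope ring_scope.

(** The proof is Wilson's second moment method, with an exact eigenfunction.

Let [q = 1 - p].  In one step the card in position [i] moves to [i + A - B],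
where [A] and [B] count the cards of its packet to its right and to its left.
They depend on disjoint sets of slots, so they are independent, and both are
geometric variables truncated at an end of the deck.  For [t = pi / n] the
function [mode t i = cos (t * (i + 1/2))] is symmetric about both ends in such a
way that the truncation effects cancel: it is an exact eigenfunction of the
motion of one card ([mode_eigen]), with an eigenvalue
[1 - q t^2 / p^2 + o(t^2)].

Weight each card by the value of the mode at its starting position, and let
[Phi] be the sum over the deck of the weight of a card times the mode at its
current position ([statistic]).  Then [Phi] starts at [n / 2] and its
mean is multiplied by the eigenvalue at each step.  At the time [f n] of the
theorem the exponent [f n * q t^2 / p^2] is [(2 - p) / (8 (1 + p)) * log n], at
most [log n / 4], so that even after giving away a factor 3/2 in the exponent
the mean of [Phi] is at least [n ^ (5/8) / 2] ([signal_ge]).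

For the variance, the fluctuation of one summand in one step has a second moment
of order [t^2] ([fluct_variance]), which is explicit because the square of a mode
is again an affine function of a mode.  Two summands at distance more than [2 r]
have a covariance of order [q ^ r], since forcing one cut between them makes them
independent and is rarely noticed ([fluct_far]).  Taking [r] of order [log n], one
step adds a variance of order [log n / n] ([fluct_sum_variance]); over [f n] steps
this accumulates to order [n (log n)^2] ([statistic_variance]).  Under the uniform
law [Phi] has mean zero and variance at most [2 n] ([uniform_second_moment]).

The square of the mean, [n ^ (5/4)], dominates both variances, so Chebyshev's
inequality separates the two laws ([tv_norm_ge]); the distance from 1 is
[O(1 / log n)] ([shuffle_tv_ge_ln]). *)

(** * Independent cuts *)

Section CutExpectation.
Variables (R : realType) (p : R) (I : finType).
Implicit Types (F G : {set I} -> R) (A : {set I}).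

Definition cut_weight (c : {set I}) : R :=
  \prod_k (if k \in c then p else 1 - p).

Definition cut_mean F : R := \sum_(c : {set I}) cut_weight c * F c.

Lemma eq_cut_mean F G : F =1 G -> cut_mean F = cut_mean G.
Proof. by move=> FG; apply: eq_bigr => c _; rewrite FG. Qed.

Lemma cut_meanD F G : cut_mean (fun c => F c + G c) = cut_mean F + cut_mean G.
Proof. by rewrite -big_split /=; apply: eq_bigr => c _; rewrite mulrDr. Qed.

Lemma cut_meanZ a F : cut_mean (fun c => a * F c) = a * cut_mean F.
Proof. by rewrite mulr_sumr; apply: eq_bigr => c _; rewrite mulrCA. Qed.

Lemma cut_meanB F G : cut_mean (fun c => F c - G c) = cut_mean F - cut_mean G.
Proof. by rewrite -sumrB; apply: eq_bigr => c _; rewrite mulrBr. Qed.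

Lemma cut_mean_sum (J : Type) (r : seq J) (F : J -> {set I} -> R) :
  cut_mean (fun c => \sum_(j <- r) F j c) = \sum_(j <- r) cut_mean (F j).
Proof.
by rewrite /cut_mean exchange_big /=; apply: eq_bigr => c _; rewrite mulr_sumr.
Qed.

Lemma cut_mean1 : cut_mean (fun=> 1) = 1.
Proof.
transitivity (\prod_(k : I) (p + (1 - p))).
  by rewrite bigA_distr; apply: eq_bigr => c _; rewrite mulr1.
by rewrite big1 // => k _; rewrite addrC subrK.
Qed.

Lemma cut_mean_const a : cut_mean (fun=> a) = a.
Proof.
transitivity (cut_mean (fun=> a * 1)); last by rewrite cut_meanZ cut_mean1 mulr1.
by apply: eq_cut_mean => c; rewrite mulr1.
Qed.

Definition avoids A : {set I} -> R := fun c => (A \subset ~: c)%:R.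

Lemma cut_mean_avoids A : cut_mean (avoids A) = (1 - p) ^+ #|A|.
Proof.
transitivity (\prod_(k : I) ((if k \in A then 0 else p) + (1 - p))).
  rewrite bigA_distr; apply: eq_bigr => c _; rewrite /avoids.
  case: (boolP (A \subset ~: c)) => [/fintype.subsetP dAc|/fintype.subsetPn[k kA]].
    rewrite mulr1; apply: eq_bigr => k _; case: ifP => // kc.
    by rewrite ifN //; apply/negP => /dAc; rewrite inE kc.
  rewrite inE negbK => kc; rewrite mulr0; apply/esym/eqP/prodf_eq0.
  by exists k => //; rewrite kc kA.
rewrite -prodr_const [RHS]big_mkcond; apply: eq_bigr => k _.
by case: ifP => _; rewrite ?add0r // addrC subrK.
Qed.

(** Exchanging the parts of two independent cut sets outside [A] preserves
their joint law; so, under it, a function of the cuts in [A] cannot tell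
whether its partner reads the same cut set or an independent one. *)
Lemma cut_mean_indep A F G :
  (forall c, F (c :&: A) = F c) -> (forall c, G (c :\: A) = G c) ->
  cut_mean (fun c => F c * G c) = cut_mean F * cut_mean G.
Proof.
move=> FA GA.
pose mix (c c' : {set I}) := (c :&: A) :|: (c' :\: A).
pose swap (cc : {set I} * {set I}) := (mix cc.1 cc.2, mix cc.2 cc.1).
have swapK : involutive swap.
  by case=> c c'; congr (_, _); apply/setP => k; rewrite !inE;
     case: (k \in A); rewrite ?(andbT, andbF, orbF).
have Fmix c c' : F (mix c c') = F c.
  rewrite -FA -[RHS]FA; congr F; apply/setP => k; rewrite !inE.
  by case: (k \in A); rewrite ?(andbT, andbF, orbF).
have Gmix c c' : G (mix c c') = G c'.
  rewrite -GA -[RHS]GA; congr G; apply/setP => k; rewrite !inE.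
  by case: (k \in A); rewrite ?(andbT, andbF, orbF).
have Wmix c c' :
    cut_weight (mix c c') * cut_weight (mix c' c) = cut_weight c * cut_weight c'.
  rewrite -!big_split; apply: eq_bigr => k _ /=; rewrite !inE.
  by case: (k \in A); rewrite ?(andbT, andbF, orbF) //= mulrC.
transitivity (\sum_(cc : {set I} * {set I})
   cut_weight cc.1 * cut_weight cc.2 * (F cc.1 * G cc.1)).
  rewrite -(pair_bigA _ (fun c c' => cut_weight c * cut_weight c' * (F c * G c))) /=.
  apply: eq_bigr => c _; rewrite -mulr_suml -mulr_sumr; congr (_ * _).
  rewrite -[LHS]mulr1; congr (_ * _).
  by rewrite -[LHS]cut_mean1; apply: eq_bigr => c' _; rewrite mulr1.
rewrite (reindex_inj (inv_inj swapK)) /=.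
rewrite big_distrlr /= pair_bigA /=; apply: eq_bigr => -[c c'] _ /=.
by rewrite Wmix Fmix Gmix; ring.
Qed.

Hypotheses (p_gt0 : 0 < p) (p_lt1 : p < 1).

Lemma cut_weight_ge0 c : 0 <= cut_weight c.
Proof. by apply: prodr_ge0 => k _; case: ifP => _; rewrite ?subr_ge0 ltW. Qed.

Lemma ler_norm_cut_mean F G :
  (forall c, `|F c| <= G c) -> `|cut_mean F| <= cut_mean G.
Proof.
move=> FG; apply: le_trans (ler_norm_sum _ _ _) _; apply: ler_sum => c _.
by rewrite normrM ger0_norm ?cut_weight_ge0 // ler_wpM2l ?cut_weight_ge0.
Qed.

End CutExpectation.

(** * Geometry of packets *)

Section PacketEnds.
Variable n : nat.
Implicit Types (c A : {set 'I_n.-1}) (i j : 'I_n) (k m : 'I_n.-1).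
Local Open Scope nat_scope.

Definition slots (a b : nat) : {set 'I_n.-1} := [set k : 'I_n.-1 | a <= k < b].

Lemma card_slots a b : b <= n.-1 -> #|slots a b| = b - a.
Proof.
move=> bn; rewrite cardE -(size_map val) -[RHS](size_iota a).
apply/perm_size/uniq_perm; rewrite ?iota_uniq ?map_inj_uniq ?enum_uniq //;
  try exact: val_inj.
move=> x; rewrite mem_iota; apply/mapP/idP => [[k]|xab].
  by rewrite mem_enum inE => kab -> /=; lia.
have xn : x < n.-1 by lia.
by exists (Ordinal xn); rewrite ?mem_enum ?inE /=; lia.
Qed.

Lemma same_packetP c i j :
  reflect (forall k, k \in c -> ~~ (minn i j <= k < maxn i j)) (same_packet c i j).
Proof. exact: forall_inP. Qed.

Lemma packet_lastE c c' i :
  (forall j, i <= j -> same_packet c i j = same_packet c' i j) ->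
  packet_last c i = packet_last c' i.
Proof.
move=> cc'; have [s1 m1] := packet_lastP c i.
have [s2 m2] := packet_lastP c' i.
have i1 := m1 _ (same_packet_refl c i).
have i2 := m2 _ (same_packet_refl c' i).
apply/val_inj/eqP; rewrite eqn_leq m2 -?cc' //= m1 ?cc' //.
Qed.

Lemma packet_firstE c c' i :
  (forall j, j <= i -> same_packet c i j = same_packet c' i j) ->
  packet_first c i = packet_first c' i.
Proof.
move=> cc'; have [s1 m1] := packet_firstP c i.
have [s2 m2] := packet_firstP c' i.
have i1 := m1 _ (same_packet_refl c i).
have i2 := m2 _ (same_packet_refl c' i).
apply/val_inj/eqP; rewrite eqn_leq m1 ?cc' //= m2 -?cc' //.
Qed.

Lemma packet_reflectE c c' i :
  (forall j, same_packet c i j = same_packet c' i j) ->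
  packet_reflect c i = packet_reflect c' i.
Proof.
move=> cc'; apply: val_inj => /=.
by rewrite (@packet_lastE c c') ?(@packet_firstE c c').
Qed.

Lemma packet_last_right c i :
  packet_last (c :&: slots i n.-1) i = packet_last c i.
Proof.
apply: packet_lastE => j ij; apply/same_packetP/same_packetP => cP k kc.
  by have := cP k; rewrite !inE kc /=; have := ltn_ord k; lia.
by apply: cP; case/setIP: kc.
Qed.

Lemma packet_first_left c i :
  packet_first (c :\: slots i n.-1) i = packet_first c i.
Proof.
apply: packet_firstE => j ij; apply/same_packetP/same_packetP => cP k kc.
  by have := cP k; rewrite !inE kc /=; have := ltn_ord k; lia.
by apply: cP; case/setDP: kc.
Qed.

Lemma packet_last_gt c i r :
  i + r < n.-1 -> (i + r < packet_last c i) = (slots i (i + r).+1 \subset ~: c).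
Proof.
move=> irn; have [/same_packetP sl ml] := packet_lastP c i.
have il := ml _ (same_packet_refl c i).
apply/idP/fintype.subsetP => [irl k|avoid].
  by rewrite !inE => kir; apply/negP => /sl; lia.
have irn' : (i + r).+1 < n by lia.
suff /ml : same_packet c i (Ordinal irn') by [].
apply/same_packetP => k kc; apply/negP => /= kir.
by have := avoid k; rewrite !inE kc /=; lia.
Qed.

Lemma packet_first_lt c i r :
  r < i -> (packet_first c i < i - r) = (slots (i - r.+1) i \subset ~: c).
Proof.
move=> ri; have [/same_packetP sl ml] := packet_firstP c i.
have il := ml _ (same_packet_refl c i).
apply/idP/fintype.subsetP => [irl k|avoid].
  by rewrite !inE => kir; apply/negP => /sl; lia.
have irn' : i - r.+1 < n by have := ltn_ord i; lia.
suff /ml fj : same_packet c i (Ordinal irn') by move: fj => /=; lia.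
apply/same_packetP => k kc; apply/negP => /= kir.
by have := avoid k; rewrite !inE kc /=; lia.
Qed.

(** A cut in the slot [m] screens each side of the deck from the other: this is
what makes the motions of two cards separated by [m] independent. *)
Lemma forced_cut_left m c i : i <= m ->
  packet_reflect (m |: (c :&: slots 0 m)) i = packet_reflect (m |: c) i.
Proof.
move=> im; apply: packet_reflectE => j.
apply/same_packetP/same_packetP => cP k; last first.
  by rewrite !inE => kc; apply: cP; rewrite !inE; case/orP: kc => [->|/andP[->]];
     rewrite ?orbT.
move=> kc; have [km|km] := ltnP k m.
  by apply: cP; move: kc; rewrite !inE /= km andbT.
by have := cP m (setU11 _ _); lia.
Qed.

Lemma forced_cut_right m c i : m < i ->
  packet_reflect (m |: (c :\: slots 0 m)) i = packet_reflect (m |: c) i.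
Proof.
move=> im; apply: packet_reflectE => j.
apply/same_packetP/same_packetP => cP k; last first.
  by rewrite !inE => kc; apply: cP; rewrite !inE; case/orP: kc => [->|/andP[_ ->]];
     rewrite ?orbT.
move=> kc; have [km|km] := leqP m k.
  by apply: cP; move: kc; rewrite !inE (ltnNge k m) km.
by have := cP m (setU11 _ _); lia.
Qed.

(** A packet that already ends before reaching [m] does not notice a cut there,
so forcing the cut has an effect of exponentially small probability. *)
Lemma forced_cut_hidden_left m c i : i <= m ->
  ~~ (slots i m \subset ~: c) -> packet_reflect (m |: c) i = packet_reflect c i.
Proof.
move=> im /fintype.subsetPn[k]; rewrite !inE negbK => kim kc.
apply: packet_reflectE => j; apply/same_packetP/same_packetP => cP k' k'c.
  by apply: cP; rewrite !inE k'c orbT.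
by move: k'c; rewrite !inE => /orP[/eqP->|/cP//]; have := cP k kc; lia.
Qed.

Lemma forced_cut_hidden_right m c i : m < i ->
  ~~ (slots m.+1 i \subset ~: c) -> packet_reflect (m |: c) i = packet_reflect c i.
Proof.
move=> im /fintype.subsetPn[k]; rewrite !inE negbK => kim kc.
apply: packet_reflectE => j; apply/same_packetP/same_packetP => cP k' k'c.
  by apply: cP; rewrite !inE k'c orbT.
by move: k'c; rewrite !inE => /orP[/eqP->|/cP//]; have := cP k kc; lia.
Qed.

End PacketEnds.

(** * The cosine eigenfunctions of the motion of one card *)

Section CosineModes.
Variables (R : realType) (p : R).
Hypotheses (p_gt0 : 0 < p) (p_lt1 : p < 1).
Let q := 1 - p.

(** The mean, after a summation by parts, of [g] at a variable with
[P (r < L) = q ^ r.+1] for [r < m] that never exceeds [m]. *)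
Definition trunc_geom_mean (m : nat) (g : nat -> R) : R :=
  g 0%N + \sum_(r < m) (g r.+1 - g r) * q ^+ r.+1.

Lemma telescope_indicator (g : nat -> R) m k : (k <= m)%N ->
  g k = g 0%N + \sum_(r < m) (g r.+1 - g r) * (r < k)%N%:R.
Proof.
move=> km; transitivity (g 0%N + \sum_(r < k) (g r.+1 - g r)).
  by rewrite -(big_mkord xpredT (fun r => g r.+1 - g r)) telescope_sumr // addrC subrK.
congr (_ + _); rewrite (big_ord_widen m (fun r => g r.+1 - g r)) // big_mkcond.
by apply: eq_bigr => r _; case: ifP => _; rewrite ?mulr1 ?mulr0.
Qed.

Variable n : nat.
Implicit Types (c : {set 'I_n.-1}) (i : 'I_n).

(** Here [L c] is a distance to the end of a packet; it exceeds [r] exactly when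
the [r.+1] slots of [A r] contain no cut. *)
Lemma cut_mean_telescope m (g : nat -> R) (L : {set 'I_n.-1} -> nat)
    (A : nat -> {set 'I_n.-1}) :
  (forall c, (L c <= m)%N) ->
  (forall c r, (r < m)%N -> (r < L c)%N = (A r \subset ~: c)) ->
  (forall r, (r < m)%N -> #|A r| = r.+1) ->
  cut_mean p (fun c => g (L c)) = trunc_geom_mean m g.
Proof.
move=> Lm LA cA.
rewrite (eq_cut_mean _ (fun c => telescope_indicator g (Lm c))).
rewrite cut_meanD cut_mean_const cut_mean_sum; congr (_ + _).
apply: eq_bigr => r _; have -> : q ^+ r.+1 = cut_mean p (avoids R (A r)).
  by rewrite cut_mean_avoids cA.
rewrite -cut_meanZ.
by apply: eq_cut_mean => c; rewrite LA.
Qed.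

Lemma cut_mean_packet_last (g : nat -> R) i :
  cut_mean p (fun c => g (packet_last c i - i)%N) = trunc_geom_mean (n.-1 - i) g.
Proof.
apply: (@cut_mean_telescope _ _ _ (fun r => slots n i (i + r).+1)) => [c|c r rm|r rm].
- by have := ltn_ord (packet_last c i); lia.
- rewrite -packet_last_gt; last by lia.
  by have [_ /(_ i (same_packet_refl c i))] := packet_lastP c i; lia.
- by rewrite card_slots; lia.
Qed.

Lemma cut_mean_packet_first (g : nat -> R) i :
  cut_mean p (fun c => g (i - packet_first c i)%N) = trunc_geom_mean i g.
Proof.
apply: (@cut_mean_telescope _ _ _ (fun r => slots n (i - r.+1) i)) => [c|c r rm|r rm].
- by have := ltn_ord (packet_last c i); lia.
- rewrite -packet_first_lt; last by lia.
  by have [_ /(_ i (same_packet_refl c i))] := packet_firstP c i; lia.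
- by rewrite card_slots; have := ltn_ord i; lia.
Qed.

Definition cosine_denom (t : R) := 1 - 2 * q * cos t + q ^+ 2.

(** This and the next lemma are the real and imaginary parts of
[a + (q z) ^ m * (1 - a)], the mean of [z ^ L] for [z = exp (i t)] and
[a = p / (1 - q z)], multiplied by [cosine_denom t = |1 - q z| ^ 2]. *)
Lemma trunc_geom_mean_cos t m :
  cosine_denom t * trunc_geom_mean m (fun r => cos (r%:R * t)) =
  p * (1 - q * cos t) + q ^+ m.+1 *
    ((1 + q) * (1 - cos t) * cos (m%:R * t) + p * sin t * sin (m%:R * t)).
Proof.
rewrite /trunc_geom_mean /cosine_denom.
elim: m => [|m IHm].
  by rewrite big_ord0 !mul0r cos0 sin0 /q; ring.
have mS : m.+1%:R * t = m%:R * t + t by rewrite -natr1 mulrDl mul1r.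
rewrite big_ord_recr /= addrA mulrDr IHm mS cosD sinD.
rewrite (exprS q m.+1); set Q := q ^+ m.+1; rewrite /q.
by ring: (sin2cos2 t).
Qed.

Lemma trunc_geom_mean_sin t m :
  cosine_denom t * trunc_geom_mean m (fun r => sin (r%:R * t)) =
  p * q * sin t + q ^+ m.+1 *
    ((1 + q) * (1 - cos t) * sin (m%:R * t) - p * sin t * cos (m%:R * t)).
Proof.
rewrite /trunc_geom_mean /cosine_denom.
elim: m => [|m IHm].
  by rewrite big_ord0 !mul0r cos0 sin0 /q; ring.
have mS : m.+1%:R * t = m%:R * t + t by rewrite -natr1 mulrDl mul1r.
rewrite big_ord_recr /= addrA mulrDr IHm mS cosD sinD.
rewrite (exprS q m.+1); set Q := q ^+ m.+1; rewrite /q.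
by ring: (sin2cos2 t).
Qed.

Definition mode t (i : nat) : R := cos (t * (i%:R + 2^-1)).

(** The sign [e = cos (n t)] records whether the mode is odd or even under the
reversal of the deck. *)
Definition mode_eigenvalue t (e : R) : R :=
  (p ^+ 2 + e * q ^+ n.+1 * (2 * (1 - cos t))) / cosine_denom t.

Lemma cosine_denomE t : cosine_denom t = p ^+ 2 + q * (2 * (1 - cos t)).
Proof. by rewrite /cosine_denom /q; ring. Qed.

Lemma cosine_denom_gt0 t : 0 < cosine_denom t.
Proof.
rewrite cosine_denomE ltr_wpDr ?exprn_gt0 // !mulr_ge0 //.
by rewrite subr_ge0 ltW.
Qed.

(** The position of the card after the reversal is [i + A - B], where [A] and
[B] count the cards to the right and to the left of [i] in its packet; they
read disjoint sets of slots, hence are independent, and each is a truncated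
geometric variable.  The truncation terms of order [q ^ i] and [q ^ (n - i)]
cancel because the phase of [mode] is symmetric about both ends of the deck;
only their product survives, in the eigenvalue. *)
Lemma mode_eigen t e i : cos (n%:R * t) = e -> sin (n%:R * t) = 0 ->
  cut_mean p (fun c => mode t (packet_reflect c i)) =
  mode_eigenvalue t e * mode t i.
Proof.
move=> cos_nt sin_nt.
have e2 : e ^+ 2 = 1 by have := cos2Dsin2 (n%:R * t); rewrite cos_nt sin_nt expr0n addr0.
pose a := t * (i%:R + 2^-1).
pose A c := (packet_last c i - i)%N; pose B c := (i - packet_first c i)%N.
have split_mode c : mode t (packet_reflect c i) =
    (cos a * cos ((A c)%:R * t) - sin a * sin ((A c)%:R * t)) * cos ((B c)%:R * t) +
    (sin a * cos ((A c)%:R * t) + cos a * sin ((A c)%:R * t)) * sin ((B c)%:R * t).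
  rewrite -sinD -cosD -cosB /mode /a; congr cos.
  have [_ /(_ i (same_packet_refl c i)) fi] := packet_firstP c i.
  have [_ /(_ i (same_packet_refl c i)) il] := packet_lastP c i.
  rewrite /= /A /B !natrB // ?natrD; last by lia.
  by ring.
pose S := slots n i n.-1.
have Aloc c : A (c :&: S) = A c by rewrite /A packet_last_right.
have Bloc c : B (c :\: S) = B c by rewrite /B packet_first_left.
rewrite (eq_cut_mean _ split_mode) cut_meanD.
rewrite (cut_mean_indep p (A := S)) => [|c|c]; rewrite ?Aloc ?Bloc //.
rewrite (cut_mean_indep p (A := S)) => [|c|c]; rewrite ?Aloc ?Bloc //.
rewrite cut_meanB cut_meanD !cut_meanZ /A /B.
rewrite (cut_mean_packet_last (fun r => cos (r%:R * t))).
rewrite (cut_mean_packet_last (fun r => sin (r%:R * t))).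
rewrite (cut_mean_packet_first (fun r => cos (r%:R * t))).
rewrite (cut_mean_packet_first (fun r => sin (r%:R * t))).
have D0 : cosine_denom t != 0 by rewrite gt_eqF ?cosine_denom_gt0.
apply: (mulfI D0); apply: (mulfI D0).
have := trunc_geom_mean_cos t (n.-1 - i); have := trunc_geom_mean_sin t (n.-1 - i).
have := trunc_geom_mean_cos t i; have := trunc_geom_mean_sin t i.
set si := trunc_geom_mean i _; set ci := trunc_geom_mean i _.
set sm := trunc_geom_mean _ _; set cm := trunc_geom_mean _ _.
set D := cosine_denom t => Esi Eci Esm Ecm.
transitivity (cos a * ((D * cm) * (D * ci) + (D * sm) * (D * si))
  - sin a * ((D * sm) * (D * ci) - (D * cm) * (D * si))); first by ring.
rewrite Esi Eci Esm Ecm.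
have DN : D * (D * (mode_eigenvalue t e * mode t i)) =
    D * ((p ^+ 2 + e * q ^+ n.+1 * (2 * (1 - cos t))) * cos a).
  by rewrite /mode_eigenvalue /mode -/a -/D; field.
rewrite {}DN {Esi Eci Esm Ecm si ci sm cm} /D cosine_denomE.
(* All the angles are combinations of h, x and n t; in these terms the claim is a
   polynomial identity modulo the Pythagorean relations. *)
pose h := t / 2; pose x := i%:R * t.
have -> : a = x + h by rewrite /a /x /h; ring.
have mt : (n.-1 - i)%:R * t = n%:R * t - (x + t).
  have -> : (n%:R : R) = (n.-1 - i)%:R + i%:R + 1.
    by rewrite -natrD natr1; congr (_%:R); have := ltn_ord i; lia.
  by rewrite /x; ring.
rewrite mt cosB sinB cos_nt sin_nt !mul0r addr0 add0r -/x.
have -> : q ^+ n.+1 = q ^+ (n.-1 - i).+1 * q ^+ i.+1.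
  by rewrite -exprD; congr (_ ^+ _); have := ltn_ord i; lia.
have th : t = h + h by rewrite /h -splitr.
rewrite th !(cosD, sinD).
have -> : p = 1 - q by rewrite /q subKr.
move: (q ^+ _) (q ^+ _) => Y X; move: (cos2Dsin2 x) (cos2Dsin2 h); move: (q) => q'.
move: (cos x) (sin x) (cos h) (sin h) => cx sx ch sh Ex Eh.
have Ex' : sx ^+ 2 = 1 - cx ^+ 2 by rewrite -Ex; ring.
have Eh' : sh ^+ 2 = 1 - ch ^+ 2 by rewrite -Eh; ring.
by ring: Ex' Eh' e2.
Qed.

Lemma mode_eigenvalue_gap t e :
  1 - mode_eigenvalue t e =
  q * (1 - e * q ^+ n) * (2 * (1 - cos t)) / cosine_denom t.
Proof.
rewrite -[in LHS](divff (lt0r_neq0 (cosine_denom_gt0 t))) -mulrBl; congr (_ / _).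
by rewrite cosine_denomE (exprS q n); ring.
Qed.

Lemma no_cut_bounds : 0 <= q <= 1.
Proof. by move: p_gt0 p_lt1; rewrite /q; lra. Qed.

Lemma expr_no_cut_bounds m : 0 <= q ^+ m <= 1.
Proof. by have /andP[q0 q1] := no_cut_bounds; rewrite exprn_ge0 ?exprn_ile1. Qed.

Lemma mode_eigenvalue_le1 t e : -1 <= e <= 1 -> -1 <= mode_eigenvalue t e <= 1.
Proof.
move=> e1; have D0 := cosine_denom_gt0 t; have := expr_no_cut_bounds n.
have /andP[q0 q1] := no_cut_bounds; move=> qn; have c1 := cos_le1 t.
apply/andP; split; last first.
  rewrite -subr_ge0 mode_eigenvalue_gap divr_ge0 ?(ltW D0) // !mulr_ge0 //; nra.
rewrite /mode_eigenvalue ler_pdivlMr // cosine_denomE (exprS q n).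
have [p0 p1] := (p_gt0, p_lt1).
have : 0 <= q * (2 * (1 - cos t)) * (1 + e * q ^+ n).
  by rewrite !mulr_ge0 //; nra.
nra.
Qed.

Lemma mode_eigenvalue_near1 t e : -1 <= e <= 1 ->
  1 - mode_eigenvalue t e <= 4 * (1 - cos t) / p ^+ 2.
Proof.
move=> e1; have qn := expr_no_cut_bounds n.
have /andP[q0 q1] := no_cut_bounds; have c1 := cos_le1 t.
have p2 : 0 < p ^+ 2 by rewrite exprn_gt0.
rewrite mode_eigenvalue_gap ler_pM ?invr_ge0 ?(ltW (cosine_denom_gt0 t)) //.
- by rewrite !mulr_ge0 //; nra.
- have x2 : 1 - e * q ^+ n <= 2 by nra.
  have x1 : q * (1 - e * q ^+ n) <= 2.
    by rewrite (le_trans (ler_wpM2l q0 x2)) // ler_piMl.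
  by rewrite (le_trans (ler_wpM2r _ x1)) // ?mulr_ge0 ?subr_ge0 //; lra.
- rewrite lef_pV2 ?posrE ?cosine_denom_gt0 // cosine_denomE lerDl.
  by rewrite !mulr_ge0 // subr_ge0.
Qed.

Lemma mode_sqr t i : mode t i ^+ 2 = 2^-1 * (1 + mode (2 * t) i).
Proof.
rewrite /mode; have -> : 2 * t * (i%:R + 2^-1) = (t * (i%:R + 2^-1)) *+ 2 by ring.
by rewrite cos_mulr2n; field.
Qed.

(** The reversal permutes the positions, so the sum of a mode over the deck is
invariant; the eigenvalue being different from 1, the sum vanishes. *)
Lemma sum_mode_eq0 t e : (0 < n)%N -> cos t < 1 ->
  cos (n%:R * t) = e -> sin (n%:R * t) = 0 -> \sum_(i < n) mode t i = 0.
Proof.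
move=> n0 ct cos_nt sin_nt.
have inv : mode_eigenvalue t e * (\sum_(i < n) mode t i) = \sum_(i < n) mode t i.
  transitivity (cut_mean p (fun c : {set 'I_n.-1} => \sum_(i < n) mode t i)); last first.
    exact: cut_mean_const.
  rewrite mulr_sumr; under eq_bigr => i _ do rewrite -(mode_eigen i cos_nt sin_nt).
  rewrite -cut_mean_sum; apply: eq_cut_mean => c.
  by rewrite [RHS](reindex_inj (inv_inj (@packet_reflectK n c))).
have gap : 0 < 1 - mode_eigenvalue t e.
  have /andP[q0 q1] := no_cut_bounds.
  have qn : q ^+ n < 1 by rewrite exprn_ilt1 // -?lt0n // /q; move: p_gt0 p_lt1; lra.
  have qn0 : 0 <= q ^+ n by rewrite exprn_ge0.
  have e1 : e <= 1 by rewrite -cos_nt cos_le1.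
  rewrite mode_eigenvalue_gap divr_gt0 ?cosine_denom_gt0 // !mulr_gt0 //.
  - by rewrite /q; move: p_lt1; lra.
  - by nra.
  - by lra.
apply/eqP; have : (1 - mode_eigenvalue t e) * (\sum_(i < n) mode t i) == 0.
  by rewrite mulrBl inv mul1r subrr.
by rewrite mulf_eq0 (gt_eqF gap).
Qed.
End CosineModes.

(** * Fluctuations in one step *)

Section Fluctuations.
Variables (R : realType) (p : R).
Hypotheses (p_gt0 : 0 < p) (p_lt1 : p < 1).
Let q := 1 - p.

Lemma one_sub_cos_le (t : R) : 1 - cos t <= t ^+ 2 / 2.
Proof.
have sin_le (x : R) : 0 <= x -> sin x ^+ 2 <= x ^+ 2.
  move=> x0; have [|x1] := leP x 1; last first.
    by have := sin_le1 x; have := sin_geN1 x; nra.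
  move=> x1.
  have [|y _] := @MVT_segment R sin cos 0 x x0 _.
    by apply: continuous_subspaceT => y; exact: continuous_sin.
  rewrite sin0 !subr0 => ->.
  by rewrite exprMn ler_piMl ?sqr_ge0 // cos2sin2 gerBl sqr_ge0.
have -> : cos t = 1 - 2 * sin (t / 2) ^+ 2.
  rewrite [in LHS](splitr t) cosD; have := cos2Dsin2 (t / 2); lra.
have sl : sin (t / 2) ^+ 2 <= (t / 2) ^+ 2.
  have [t0|t0] := leP 0 (t / 2); first exact: sin_le.
  by have := @sin_le (- (t / 2)); rewrite sinN !sqrrN => -> //; lra.
nra.
Qed.

Variables (n : nat) (t e : R).
Hypotheses (cos_nt : cos (n%:R * t) = e) (sin_nt : sin (n%:R * t) = 0).
Implicit Types (c : {set 'I_n.-1}) (i j : 'I_n).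

Let lam := mode_eigenvalue p n t e.

Definition fluct c i := mode t (packet_reflect c i) - lam * mode t i.

Lemma end_phase_bounds : -1 <= e <= 1.
Proof. by rewrite -cos_nt cos_geN1 cos_le1. Qed.

Lemma fluct_eigenvalue_bounds : -1 <= lam <= 1.
Proof. exact: mode_eigenvalue_le1 end_phase_bounds. Qed.

Lemma mode_bound (s : R) k : -1 <= mode s k <= 1.
Proof. by rewrite cos_geN1 cos_le1. Qed.

Lemma fluct_mean i : cut_mean p (fun c => fluct c i) = 0.
Proof. by rewrite cut_meanB cut_mean_const (mode_eigen _ _ _ cos_nt) // subrr. Qed.

(** The square of a mode is an affine function of the mode of twice the frequency,
which is again an eigenfunction; the variance is therefore an explicit function
of the two eigenvalues, both of which are within [O(t ^ 2)] of 1. *)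
Lemma fluct_variance i : cut_mean p (fun c => fluct c i ^+ 2) <= 8 * t ^+ 2 / p ^+ 2.
Proof.
have cos_2nt : cos (n%:R * (2 * t)) = 1.
  have -> : n%:R * (2 * t) = (n%:R * t) *+ 2 by ring.
  by rewrite cos_mulr2n cos2sin2 sin_nt expr0n /= subr0 mulr2n addrK.
have sin_2nt : sin (n%:R * (2 * t)) = 0.
  have -> : n%:R * (2 * t) = (n%:R * t) *+ 2 by ring.
  by rewrite sin_mulr2n sin_nt mulr0 mul0rn.
set lam2 := mode_eigenvalue p n (2 * t) 1.
have E2 := mode_eigen p_gt0 p_lt1 i cos_2nt sin_2nt.
have E1 := mode_eigen p_gt0 p_lt1 i cos_nt sin_nt.
have -> : cut_mean p (fun c => fluct c i ^+ 2) =
    2^-1 * (1 + lam2 * mode (2 * t) i) - (lam * mode t i) ^+ 2.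
  pose a := lam * mode t i.
  transitivity (cut_mean p (fun c : {set 'I_n.-1} =>
    2^-1 * (1 + mode (2 * t) (packet_reflect c i))
      - (2 * a) * mode t (packet_reflect c i) + a ^+ 2)).
    by apply: eq_cut_mean => c; rewrite -mode_sqr /fluct -/a; ring.
  rewrite cut_meanD cut_meanB !cut_meanZ cut_meanD !cut_mean_const.
  by rewrite E1 E2 -/a -/lam2 -/lam -/a; ring.
have m2 : mode (2 * t) i = 2 * mode t i ^+ 2 - 1 by rewrite mode_sqr; field.
have near1 : 1 - lam <= 2 * t ^+ 2 / p ^+ 2.
  apply: le_trans (mode_eigenvalue_near1 p_gt0 p_lt1 n t end_phase_bounds) _.
  rewrite ler_wpM2r ?invr_ge0 ?sqr_ge0 //.
  by have := one_sub_cos_le t; lra.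
have near2 : 1 - lam2 <= 8 * t ^+ 2 / p ^+ 2.
  apply: le_trans (mode_eigenvalue_near1 p_gt0 p_lt1 n _ _) _; first by apply/andP; split; lra.
  rewrite ler_wpM2r ?invr_ge0 ?sqr_ge0 //.
  by have := one_sub_cos_le (2 * t); lra.
have /andP[l21 l22] : -1 <= lam2 <= 1 by apply: (mode_eigenvalue_le1 p_gt0 p_lt1); lra.
have /andP[l1 l2] := fluct_eigenvalue_bounds; have /andP[b1 b2] := mode_bound t i.
have ms : mode t i ^+ 2 <= 1 by nra.
have ms0 : 0 <= mode t i ^+ 2 by rewrite sqr_ge0.
rewrite -/lam2 m2 exprMn; move: near1 near2.
have -> : 8 * t ^+ 2 / p ^+ 2 = 4 * (2 * t ^+ 2 / p ^+ 2) by ring.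
move: (2 * t ^+ 2 / p ^+ 2) => w; move: (mode t i ^+ 2) ms ms0 => s s1 s0 w1 w2.
have lam_sqr : 1 - lam ^+ 2 <= 2 * w by nra.
have lam_sqr0 : 0 <= 1 - lam ^+ 2 by nra.
have : (lam2 - lam ^+ 2) * s <= 1 - lam ^+ 2.
  by apply: le_trans (ler_wpM2r s0 (lerB l22 (lexx _))) _; rewrite ler_piMr.
lra.
Qed.

Lemma fluct_bound c i : `|fluct c i| <= 2.
Proof.
rewrite ler_norml /fluct; have /andP[l1 l2] := fluct_eigenvalue_bounds.
have /andP[b1 b2] := mode_bound t i.
have /andP[d1 d2] := mode_bound t (packet_reflect c i).
have : -1 <= lam * mode t i <= 1.
  by rewrite -ler_norml normrM mulr_ile1 // ler_norml ?l1 ?b1.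
by lra.
Qed.

Lemma fluct_near i j :
  `|cut_mean p (fun c => fluct c i * fluct c j)| <= 8 * t ^+ 2 / p ^+ 2.
Proof.
apply: (@le_trans _ _ (cut_mean p (fun c =>
    2^-1 * (fluct c i ^+ 2 + fluct c j ^+ 2)))).
  apply: ler_norm_cut_mean => // c; rewrite ler_norml.
  move: (fluct c i) (fluct c j) => x y.
  by have := sqr_ge0 (x - y); have := sqr_ge0 (x + y); nra.
rewrite cut_meanZ cut_meanD.
by have := fluct_variance i; have := fluct_variance j; lra.
Qed.

Lemma fluct_forced_left c (m : 'I_n.-1) i : (i <= m)%N ->
  `|fluct (m |: c) i - fluct c i| <= 2 * avoids R (slots n i m) c.
Proof.
move=> im; rewrite /avoids; case: (boolP (_ \subset _)) => [_|cut].
  rewrite mulr1 /fluct opprB addrA subrK ler_norml.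
  have := mode_bound t (packet_reflect c i).
  by have := mode_bound t (packet_reflect (m |: c) i); lra.
by rewrite mulr0 /fluct forced_cut_hidden_left // subrr normr0.
Qed.

Lemma fluct_forced_right c (m : 'I_n.-1) i : (m < i)%N ->
  `|fluct (m |: c) i - fluct c i| <= 2 * avoids R (slots n m.+1 i) c.
Proof.
move=> im; rewrite /avoids; case: (boolP (_ \subset _)) => [_|cut].
  rewrite mulr1 /fluct opprB addrA subrK ler_norml.
  have := mode_bound t (packet_reflect c i).
  by have := mode_bound t (packet_reflect (m |: c) i); lra.
by rewrite mulr0 /fluct forced_cut_hidden_right // subrr normr0.
Qed.

(** Forcing a cut at a slot [m] between [i] and [j] makes the two
fluctuations independent, and changes them only if there is no cut between [m]
and [i], respectively between [m] and [j]. *)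
Lemma fluct_far i j r : (i + r.*2 < j)%N ->
  `|cut_mean p (fun c => fluct c i * fluct c j)| <= 12 * q ^+ r.
Proof.
move=> irj; have mn : (i + r < n.-1)%N by have := ltn_ord j; lia.
pose m := Ordinal mn; have im : (i <= m)%N by rewrite /=; lia.
have mj : (m < j)%N by rewrite /=; lia.
pose F c := fluct (m |: c) i; pose G c := fluct (m |: c) j.
have qr0 : 0 <= q ^+ r by have /andP[] := expr_no_cut_bounds p_gt0 p_lt1 r.
have EA : cut_mean p (avoids R (slots n i m)) = q ^+ r.
  by rewrite cut_mean_avoids card_slots /= ?addKn //; lia.
have EB : cut_mean p (avoids R (slots n m.+1 j)) <= q ^+ r.
  rewrite cut_mean_avoids card_slots; last by have := ltn_ord j; lia.
  have -> : (j - m.+1 = r + (j - m.+1 - r))%N by rewrite /=; lia.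
  rewrite exprD ler_piMr //.
  by have /andP[] := expr_no_cut_bounds p_gt0 p_lt1 (j - m.+1 - r).
have EFG : cut_mean p (fun c => F c * G c) = cut_mean p F * cut_mean p G.
  apply: (cut_mean_indep p (A := slots n 0 m)) => c.
    by rewrite /F /fluct forced_cut_left.
  by rewrite /G /fluct forced_cut_right.
have EF : `|cut_mean p F| <= 2 * q ^+ r.
  rewrite -[cut_mean p F]subr0 -(fluct_mean i) -cut_meanB -EA -cut_meanZ.
  by apply: ler_norm_cut_mean => // c; exact: fluct_forced_left.
have EG : `|cut_mean p G| <= 2.
  rewrite -[leRHS](cut_mean_const p ('I_n.-1 : finType)).
  by apply: ler_norm_cut_mean => // c; exact: fluct_bound.
have Ediff : `|cut_mean p (fun c => fluct c i * fluct c j - F c * G c)| <= 8 * q ^+ r.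
  apply: (@le_trans _ _ (cut_mean p (fun c =>
      4 * (avoids R (slots n i m) c + avoids R (slots n m.+1 j) c)))).
    apply: ler_norm_cut_mean => // c.
    have -> : fluct c i * fluct c j - F c * G c =
      - ((F c - fluct c i) * fluct c j + F c * (G c - fluct c j)) by ring.
    rewrite normrN (le_trans (ler_normD _ _)) // !normrM mulrDr.
    have -> : 4 = 2 * 2 :> R by ring.
    rewrite lerD //.
      rewrite mulrAC ler_pM // ?fluct_bound //; exact: fluct_forced_left.
    rewrite -mulrA ler_pM // ?fluct_bound //; exact: fluct_forced_right.
  by rewrite cut_meanZ cut_meanD EA; lra.
move: Ediff; rewrite cut_meanB EFG => Ediff.
have -> : cut_mean p (fun c => fluct c i * fluct c j) =
  (cut_mean p (fun c => fluct c i * fluct c j) - cut_mean p F * cut_mean p G)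
   + cut_mean p F * cut_mean p G by rewrite subrK.
rewrite (le_trans (ler_normD _ _)) // normrM.
have := ler_pM (normr_ge0 _) (normr_ge0 _) EF EG; lra.
Qed.

Lemma card_near i s : (#|[pred j : 'I_n | (i <= j + s) && (j <= i + s)]| <= s.*2.+1)%N.
Proof.
rewrite cardE -(size_map val) -[leqRHS](size_iota (i - s)).
apply: uniq_leq_size; first by rewrite map_inj_uniq ?enum_uniq //; exact: val_inj.
by move=> x /mapP[j]; rewrite mem_enum mem_iota => ij ->; move: ij; rewrite inE /=; lia.
Qed.

(** The [4 r + 1] positions within distance [2 r] of a given one are bounded by
[fluct_near], all the others by [fluct_far]; for [r] of order [log n] with a
large enough constant the latter are negligible. *)
Lemma fluct_sum_variance (w : 'I_n -> R) r : (forall i, `|w i| <= 1) ->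
  cut_mean p (fun c => (\sum_i w i * fluct c i) ^+ 2) <=
  n%:R * (4 * r%:R + 1) * (8 * t ^+ 2 / p ^+ 2) + 12 * n%:R ^+ 2 * q ^+ r.
Proof.
move=> w1; set v := 8 * t ^+ 2 / p ^+ 2.
have v0 : 0 <= v by rewrite /v divr_ge0 ?sqr_ge0 // mulr_ge0 ?sqr_ge0.
have qr0 : 0 <= q ^+ r by have /andP[] := expr_no_cut_bounds p_gt0 p_lt1 r.
pose E i j := cut_mean p (fun c => fluct c i * fluct c j).
have -> : cut_mean p (fun c => (\sum_i w i * fluct c i) ^+ 2) =
    \sum_i \sum_j w i * w j * E i j.
  transitivity (cut_mean p (fun c => \sum_i \sum_j w i * w j * (fluct c i * fluct c j))).
    apply: eq_cut_mean => c; rewrite expr2 big_distrlr /=.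
    by apply: eq_bigr => i _; apply: eq_bigr => j _; ring.
  rewrite cut_mean_sum; apply: eq_bigr => i _.
  by rewrite cut_mean_sum; apply: eq_bigr => j _; rewrite cut_meanZ.
pose near (i j : 'I_n) := ((i <= j + r.*2) && (j <= i + r.*2))%N.
apply: (@le_trans _ _ (\sum_(i < n) \sum_(j < n) (12 * q ^+ r + (near i j)%:R * v))).
  apply: ler_sum => i _; apply: ler_sum => j _.
  apply: le_trans (ler_norm _) _; rewrite normrM.
  apply: (@le_trans _ _ (`|E i j|)).
    by rewrite ler_piMl // normrM mulr_ile1.
  rewrite /near; case: (boolP (_ && _)) => [_|far].
    by rewrite mul1r (le_trans (fluct_near i j)) // lerDr mulr_ge0.
  rewrite mul0r addr0; have [ij|ij] := ltnP i j.
    by apply: fluct_far; lia.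
  rewrite /E (eq_cut_mean _ (G := fun c => fluct c j * fluct c i)).
    by apply: fluct_far; lia.
  by move=> c; rewrite mulrC.
apply: (@le_trans _ _ (\sum_(i < n) (n%:R * (12 * q ^+ r) + (4 * r%:R + 1) * v))).
  apply: ler_sum => i _; rewrite big_split /= sumr_const card_ord -[_ *+ n]mulr_natl lerD2l.
  rewrite -mulr_suml ler_wpM2r // -natr_sum.
  rewrite -natrM natr1 ler_nat; apply: leq_trans (_ : _ <= (r.*2).*2.+1)%N _; last by lia.
  apply: leq_trans _ (card_near i r.*2); rewrite -sum1_card [leqRHS]big_mkcond /=.
  by apply: leq_sum => j _; rewrite inE /near /=; case: ifP.
by rewrite sumr_const card_ord -[_ *+ n]mulr_natl; lra.
Qed.

End Fluctuations.

(** * Laws of a finite Markov chain *)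

Section Laws.
Variables (R : realType) (d : measure_display) (T : measurableType d).
Variable P : probability T R.

Definition pr (E : set T) : R := fine (P E).

Lemma pr_ge0 E : 0 <= pr E.
Proof. by rewrite /pr fine_ge0. Qed.

Lemma prE E : measurable E -> P E = (pr E)%:E.
Proof. by move=> mE; rewrite /pr fineK // fin_num_measure. Qed.

Lemma pr_total (F : finType) (Y : T -> F) (E : set T) :
  measurable E -> (forall y, measurable [set w | Y w = y]) ->
  pr E = \sum_y pr (E `&` [set w | Y w = y]).
Proof.
move=> mE mY; have mEY y : measurable (E `&` [set w | Y w = y]) by exact: measurableI.
apply: EFin_inj; rewrite -prE // -sumEFin.
under eq_bigr => y _ do rewrite -prE //.
rewrite -[RHS]big_enum fsbig_seq ?enum_uniq //= -measure_fin_bigcup //.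
- congr (P _); apply/seteqP; split => w /=.
    by move=> Ew; exists (Y w) => //=; rewrite mem_enum.
  by case=> y _ [].
- by move=> y z _ _ [w [[_ /= <-] [_ /= <-]]].
Qed.

Variables (S : finType) (K : S -> S -> R) (x0 : S) (X : nat -> T -> S).
Hypothesis chainX : markov_chain P K x0 X.

Lemma measurable_chain t s : measurable [set w | X t w = s].
Proof. by case: chainX. Qed.

Lemma law_ge0 t s : 0 <= law P (X t) s.
Proof. exact: pr_ge0. Qed.

Lemma sum_law t : \sum_s law P (X t) s = 1.
Proof.
have := pr_total measurableT (measurable_chain t).
rewrite {1}/pr probability_setT /= => ->.
by apply: eq_bigr => s _; rewrite setTI.
Qed.

Lemma law0 s : law P (X 0%N) s = (s == x0)%:R.
Proof.
have := sum_law 0; rewrite (bigD1 x0) //=.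
have -> : law P (X 0%N) x0 = 1 by case: chainX => _ P0 _; rewrite /law P0.
move=> sum0; have [->|sx] := eqVneq s x0.
  by case: chainX => _ P0 _; rewrite /law P0.
apply/eqP; rewrite eq_le law_ge0 andbT.
have : \sum_(i | i != x0) law P (X 0%N) i = 0 by lra.
rewrite (bigD1 s) //=; set rest := (X in _ + X = _) => sum_rest.
have : 0 <= rest by apply: sumr_ge0 => i _; exact: law_ge0.
lra.
Qed.

(** Summing the path probabilities over all the pasts before time [t] yields
the Chapman-Kolmogorov equation. *)
Lemma law_step t s' : law P (X t.+1) s' = \sum_s law P (X t) s * K s s'.
Proof.
(* The trajectory that follows the past y, then visits s and s'. *)
pose path (y : {ffun 'I_t -> S}) s i :=
  if insub i is Some j then y j else if i == t then s else s'.
pose Y w := [ffun i : 'I_t => X i w].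
have mY y : measurable [set w | Y w = y].
  have -> : [set w | Y w = y] = \bigcap_(i in [set: 'I_t]) [set w | X i w = y i].
    apply/seteqP; split => w /=; first by move=> <- i _; rewrite ffunE.
    by move=> Xy; apply/ffunP => i; rewrite ffunE Xy.
  apply: fin_bigcap_measurable => // i _; exact: measurable_chain.
have mX u s := measurable_chain u s.
rewrite /law -[fine _]/(pr _) (pr_total (mX t.+1 s') (mX t)).
apply: eq_bigr => s _; rewrite -[fine _]/(pr _).
rewrite (pr_total (measurableI _ _ (mX t.+1 s') (mX t s)) mY).
rewrite (pr_total (mX t s) mY) mulr_suml; apply: eq_bigr => y _.
have path_lt (j : 'I_t) : path y s j = y j by rewrite /path valK.
have path_t : path y s t = s by rewrite /path insubF ?ltnn // eqxx.
have path_t1 : path y s t.+1 = s'.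
  by rewrite /path insubF ?ltnNge ?leqnSn // (gtn_eqF (ltnSn t)).
have ev1 : [set w | X t w = s] `&` [set w | Y w = y] =
    [set w | forall i, (i <= t)%N -> X i w = path y s i].
  apply/seteqP; split => w /=.
    move=> [Xs Yy] i; rewrite leq_eqVlt => /orP[/eqP->|it]; first by rewrite path_t.
    by rewrite -[i]/(val (Ordinal it)) path_lt -Yy ffunE.
  move=> Xp; split; first by rewrite Xp.
  by apply/ffunP => i; rewrite ffunE Xp ?path_lt // ltnW.
have ev2 : [set w | X t.+1 w = s'] `&` [set w | X t w = s] `&` [set w | Y w = y] =
    [set w | forall i, (i <= t.+1)%N -> X i w = path y s i].
  rewrite -setIA ev1; apply/seteqP; split => w /=.
    move=> [Xs Xp] i; rewrite leq_eqVlt => /orP[/eqP->|/Xp//].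
    by rewrite path_t1.
  by move=> Xp; split=> [|i it]; [rewrite Xp | apply: Xp; exact: leqW].
case: chainX => _ _ /(_ t (path y s)); rewrite -ev1 -ev2 path_t path_t1.
have mst : measurable ([set w | X t w = s] `&` [set w | Y w = y]) by exact: measurableI.
rewrite (prE mst) prE; last by rewrite -setIA; exact: measurableI.
by rewrite -EFinM => -[->].
Qed.

Lemma law_step_mean t (G : S -> R) :
  \sum_s law P (X t.+1) s * G s =
  \sum_s law P (X t) s * (\sum_s' K s s' * G s').
Proof.
under eq_bigr => s _ do rewrite law_step mulr_suml.
rewrite exchange_big /=; apply: eq_bigr => s _; rewrite mulr_sumr.
by apply: eq_bigr => s' _; rewrite mulrA.
Qed.

End Laws.

(** * Separating two laws by a statistic *)

Section TotalVariation.
Variables (R : realType) (S : finType) (mu nu : S -> R).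
Hypotheses (mu_ge0 : forall s, 0 <= mu s) (nu_ge0 : forall s, 0 <= nu s).
Hypotheses (sum_mu : \sum_s mu s = 1) (sum_nu : \sum_s nu s = 1).

Lemma tv_norm_le1 : tv_norm mu nu <= 1.
Proof.
rewrite /tv_norm ler_pdivrMl // mulr1 -[leRHS]/(1 + 1) -{1}sum_mu -sum_nu -big_split.
apply: ler_sum => s _; rewrite (le_trans (ler_normB _ _)) //.
by rewrite !ger0_norm.
Qed.

(** Chebyshev's inequality under both laws shows that the event [m / 2 <= F]
has almost full mass under [mu] and almost none under [nu]. *)
Lemma tv_norm_ge (F : S -> R) (m V W : R) : 0 < m ->
  \sum_s mu s * (F s - m) ^+ 2 <= V -> \sum_s nu s * F s ^+ 2 <= W ->
  1 - 4 * (V + W) / m ^+ 2 <= tv_norm mu nu.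
Proof.
move=> m0 FV FW; pose A s : R := (m / 2 <= F s)%R%:R.
have m2 : 0 < m ^+ 2 by rewrite exprn_gt0.
have muA : 1 - 4 / m ^+ 2 * V <= \sum_s mu s * A s.
  apply: (@le_trans _ _ (\sum_s mu s * (1 - 4 / m ^+ 2 * (F s - m) ^+ 2))).
    under eq_bigr => s _ do rewrite mulrBr mulr1 mulrCA.
    rewrite sumrB sum_mu -mulr_sumr lerD2l lerN2 ler_wpM2l // divr_ge0 //.
    exact: ltW.
  apply: ler_sum => s _; rewrite ler_wpM2l // /A; case: (leP (m / 2) (F s)) => mF /=.
    rewrite gerBl mulr_ge0 ?sqr_ge0 // divr_ge0 //; exact: ltW.
  rewrite subr_le0 mulrAC ler_pdivlMr // mul1r.
  have : 0 <= (m / 2 - F s) * (m + (m / 2 - F s)) by rewrite mulr_ge0; lra.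
  nra.
have nuA : \sum_s nu s * A s <= 4 / m ^+ 2 * W.
  apply: (@le_trans _ _ (\sum_s nu s * (4 / m ^+ 2 * F s ^+ 2))); last first.
    under eq_bigr => s _ do rewrite mulrCA.
    by rewrite -mulr_sumr ler_wpM2l // divr_ge0 // ltW.
  apply: ler_sum => s _; rewrite ler_wpM2l // /A; case: (leP (m / 2) (F s)) => mF /=.
    rewrite mulrAC ler_pdivlMr // mul1r; nra.
  by rewrite mulr_ge0 ?sqr_ge0 // divr_ge0 // ltW.
have tvA : \sum_s mu s * A s - \sum_s nu s * A s <= tv_norm mu nu.
  rewrite /tv_norm ler_pdivlMl //.
  have -> : 2 * (\sum_s mu s * A s - \sum_s nu s * A s) =
      \sum_s (mu s - nu s) * (2 * A s - 1).
    transitivity (2 * (\sum_s mu s * A s - \sum_s nu s * A s)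
      - (\sum_s mu s - \sum_s nu s)); first by rewrite sum_mu sum_nu subrr subr0.
    rewrite -!sumrB mulr_sumr -sumrB.
    by apply: eq_bigr => s _; ring.
  apply: ler_sum => s _; rewrite (le_trans (ler_norm _)) // normrM.
  rewrite ler_piMr // /A; case: (leP (m / 2) (F s)) => _ /=.
    by rewrite ler_norml; lra.
  by rewrite ler_norml; lra.
have -> : 4 * (V + W) / m ^+ 2 = 4 / m ^+ 2 * V + 4 / m ^+ 2 * W by ring.
lra.
Qed.

End TotalVariation.

Section Statistic.
Variables (R : realType) (n : nat) (phi w : 'I_n -> R).
Hypothesis w_le1 : forall i, `|w i| <= 1.

Definition statistic (s : 'S_n) : R := \sum_i w (s i) * phi i.

Lemma sum_uniform_law (S : finType) (x : S) : \sum_s @uniform_law R S s = 1.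
Proof.
rewrite /uniform_law sumr_const -[_ *+ _]mulr_natl divff // pnatr_eq0 -lt0n; apply/card_gt0P.
by exists x.
Qed.

(** Under the uniform law the cards in the positions [i] and [j] have the same
joint law for every [j != i]; as [phi] has sum zero, all the off-diagonal
covariances together weigh no more than the diagonal ones. *)
Lemma uniform_second_moment :
  (forall i, `|phi i| <= 1) -> \sum_i phi i = 0 ->
  \sum_s uniform_law R s * statistic s ^+ 2 <= 2 * n%:R.
Proof.
move=> phi1 phi0.
pose W i j := \sum_(s : 'S_n) uniform_law R s * (w (s i) * w (s j)).
have W1 i j : `|W i j| <= 1.
  rewrite -(sum_uniform_law (1%g : 'S_n)) (le_trans (ler_norm_sum _ _ _)) //.
  apply: ler_sum => s _; rewrite normrM ger0_norm ?invr_ge0 //.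
  by rewrite ler_piMr ?invr_ge0 // normrM mulr_ile1.
have WE i j j' : j != i -> j' != i -> W i j = W i j'.
  move=> ji j'i; rewrite /W (reindex_inj (mulgI (tperm j j'))) /=.
  by apply: eq_bigr => s _; rewrite !permM tpermL tpermD.
pose v i := if [pick j | j != i] is Some j then W i j else 0.
have v1 i : `|v i| <= 1.
  by rewrite /v; case: pickP => [j _|_]; rewrite ?normr0.
have off i : \sum_(j | j != i) phi j * W i j = - v i * phi i.
  have -> : - v i * phi i = v i * (\sum_(j | j != i) phi j).
    have := phi0; rewrite (bigD1 i) //= => /eqP; rewrite addr_eq0 => /eqP ->.
    by rewrite mulrN mulNr opprK.
  rewrite mulr_sumr; apply: eq_bigr => j ji; rewrite mulrC /v.
  case: pickP => [j' j'i|/(_ j)]; last by rewrite ji.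
  by rewrite (WE i j j').
have -> : \sum_s uniform_law R s * statistic s ^+ 2 =
    \sum_i phi i * (\sum_j phi j * W i j).
  transitivity (\sum_(s : 'S_n) \sum_i \sum_j
      phi i * (phi j * (uniform_law R s * (w (s i) * w (s j))))).
    apply: eq_bigr => s _; rewrite /statistic expr2 big_distrlr mulr_sumr /=.
    apply: eq_bigr => i _; rewrite mulr_sumr; apply: eq_bigr => j _; ring.
  rewrite exchange_big; apply: eq_bigr => i _; rewrite exchange_big mulr_sumr.
  by apply: eq_bigr => j _; rewrite /W !mulr_sumr.
apply: (@le_trans _ _ (\sum_(i < n) 2)).
  apply: ler_sum => i _; rewrite (bigD1 i) //= off.
  have -> : phi i * (phi i * W i i + - v i * phi i) = phi i ^+ 2 * (W i i - v i).
    by ring.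
  have := phi1 i; have := W1 i i; have := v1 i; rewrite !ler_norml.
  move=> /andP[? ?] /andP[? ?] /andP[? ?].
  have s1 : 0 <= phi i ^+ 2 <= 1 by rewrite sqr_ge0 /=; nra.
  nra.
by rewrite sumr_const card_ord mulr_natr.
Qed.

End Statistic.

(** * The statistic along the shuffle *)

Section ShuffleStatistic.
Variables (R : realType) (p : R).
Hypotheses (p_gt0 : 0 < p) (p_lt1 : p < 1).
Variables (n : nat) (t e : R).
Hypotheses (cos_nt : cos (n%:R * t) = e) (sin_nt : sin (n%:R * t) = 0).
Variable w : 'I_n -> R.

Let lam := mode_eigenvalue p n t e.
Let phi (i : 'I_n) := mode t i.
Let Phi := statistic phi w.

Lemma overhand_mean (s : 'S_n) (G : 'S_n -> R) :
  \sum_s' overhand p s s' * G s' = cut_mean p (fun c => G (reverse_packets c s)).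
Proof.
rewrite /overhand /cut_mean.
under eq_bigr => s' _ do rewrite mulr_suml.
rewrite (exchange_big_dep predT) //=; apply: eq_bigr => c _.
by rewrite (big_pred1 (reverse_packets c s)) // => s' /=; rewrite eq_sym.
Qed.

Lemma statistic_step c s :
  Phi (reverse_packets c s) = lam * Phi s + \sum_i w (s i) * fluct p t e c i.
Proof.
rewrite /Phi /statistic (reindex_inj (inv_inj (@packet_reflectK n c))) /=.
rewrite mulr_sumr -big_split; apply: eq_bigr => i _ /=.
by rewrite reverse_packetsE packet_reflectK /fluct /phi -/lam; ring.
Qed.

Variables (d : measure_display) (T : measurableType d) (P : probability T R).
Variables (x0 : 'S_n) (X : nat -> T -> 'S_n).
Hypothesis chainX : markov_chain P (@overhand R p n) x0 X.

(** The fluctuations of successive steps have mean zero given the past, so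
their variances add up, while the eigenvalue can only contract them. *)
Lemma statistic_variance (B : R) k :
  (forall s : 'S_n,
    cut_mean p (fun c => (\sum_i w (s i) * fluct p t e c i) ^+ 2) <= B) ->
  \sum_s law P (X k) s * (Phi s - lam ^+ k * Phi x0) ^+ 2 <= k%:R * B.
Proof.
move=> hB; elim: k => [|k IHk].
  rewrite mul0r big1 // => s _; rewrite (law0 chainX).
  by case: eqVneq => [->|_]; rewrite ?mul0r // expr0 mul1r subrr expr0n mulr0.
rewrite (law_step_mean chainX) -natr1 mulrDl mul1r.
apply: le_trans (lerD IHk (lexx B)).
rewrite -[X in _ <= _ + X]mul1r -(sum_law chainX k) mulr_suml -big_split /=.
apply: ler_sum => s _; rewrite -mulrDr ler_wpM2l ?law_ge0 // overhand_mean.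
set a := lam ^+ k * Phi x0; pose D c := \sum_i w (s i) * fluct p t e c i.
have -> : cut_mean p (fun c => (Phi (reverse_packets c s) - lam ^+ k.+1 * Phi x0) ^+ 2)
   = cut_mean p (fun c => (lam * (Phi s - a)) ^+ 2 + 2 * (lam * (Phi s - a)) * D c + D c ^+ 2).
  apply: eq_cut_mean => c; by rewrite statistic_step -/(D c) (exprS lam k) -(mulrA lam) -/a; ring.
rewrite !cut_meanD cut_mean_const cut_meanZ.
have -> : cut_mean p D = 0.
  rewrite cut_mean_sum big1 // => i _.
  by rewrite cut_meanZ (fluct_mean p_gt0 p_lt1 cos_nt sin_nt) mulr0.
rewrite mulr0 addr0 lerD //; last exact: hB.
have : -1 <= lam <= 1 := fluct_eigenvalue_bounds p_gt0 p_lt1 cos_nt.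
move: lam => l /andP[l1 l2].
by rewrite exprMn ler_piMl ?sqr_ge0 //; nra.
Qed.

End ShuffleStatistic.

(** * Total variation distance for one deck *)

Section Asymptotics.
Variables (R : realType) (p : R).
Hypotheses (p_gt0 : 0 < p) (p_lt1 : p < 1).
Let q := 1 - p.

Lemma no_cut_gt0 : 0 < q.
Proof. by rewrite subr_gt0. Qed.

(** To first order the eigenvalue is [1 - x]; the factor [3 / 2] pays both for
the higher order terms, through [exp (- y) <= 1 / (1 + y)], and for the
correction of order [q ^ n] in the eigenvalue. *)
Lemma first_eigenvalue_ge n (t : R) : let x := q * t ^+ 2 / p ^+ 2 in
  x <= 2 / 3 -> q ^+ n <= 1 / 4 ->
  expR (- (3 / 2 * x)) <= mode_eigenvalue p n t (-1).
Proof.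
move=> x x1 qn; have q0 := no_cut_gt0.
have p2 : 0 < p ^+ 2 by rewrite exprn_gt0.
have D0 := cosine_denom_gt0 p_gt0 p_lt1 t.
have x0 : 0 <= x by rewrite /x divr_ge0 ?sqr_ge0 // mulr_ge0 ?sqr_ge0 // ltW.
have qn0 : 0 <= q ^+ n by rewrite exprn_ge0 ?ltW.
apply: (@le_trans _ _ (1 + 3 / 2 * x)^-1).
  rewrite expRN lef_pV2 ?posrE ?expR_gt0 ?expR_ge1Dx //.
  by rewrite ltr_wpDr // mulr_ge0.
rewrite /mode_eigenvalue ler_pdivlMr // ler_pdivrMl; last by rewrite ltr_wpDr // mulr_ge0.
rewrite cosine_denomE -/q (exprS q n).
set u := 2 * (1 - cos t).
have u0 : 0 <= u by rewrite mulr_ge0 // subr_ge0 cos_le1.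
have qu : q * u <= p ^+ 2 * x.
  rewrite /x [leRHS]mulrC divfK ?gt_eqF // ler_wpM2l ?(ltW q0) //.
  by have := one_sub_cos_le t; rewrite /u; lra.
have tail : q ^+ n * (1 + 3 / 2 * x) <= 1 / 2.
  have -> : 1 / 2 = 1 / 4 * 2 :> R by field.
  by apply: ler_pM => //; lra.
have qu0 : 0 <= q * u by rewrite mulr_ge0 // ltW.
have := ler_pM qu0 _ qu tail.
have tail0 : 0 <= q ^+ n * (1 + 3 / 2 * x) by rewrite mulr_ge0 // addr_ge0 // mulr_ge0.
move=> /(_ tail0); nra.
Qed.

Section OneDeck.
Variables (n : nat) (d : measure_display) (T : measurableType d).
Variables (P : probability T R) (x0 : 'S_n) (X : nat -> T -> 'S_n).
Hypothesis chainX : markov_chain P (@overhand R p n) x0 X.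
Hypothesis n_ge2 : (2 <= n)%N.

(** The card that starts in position [i] gets the weight [mode t i], so that the
statistic starts at the sum of the squares of the mode, which is [n / 2] because
the mode of frequency [2 t] has sum zero. *)
Lemma shuffle_tv_ge k r : let t := pi / n%:R : R in
  let lam := mode_eigenvalue p n t (-1) in
  let B := n%:R * (4 * r%:R + 1) * (8 * t ^+ 2 / p ^+ 2) + 12 * n%:R ^+ 2 * q ^+ r in
  0 < lam ->
  1 - 4 * (k%:R * B + 2 * n%:R) / (lam ^+ k * (n%:R / 2)) ^+ 2 <=
    tv_norm (law P (X k)) (@uniform_law R _).
Proof.
move=> t lam B lam0.
have n0 : 0 < n%:R :> R by rewrite ltr0n; lia.
have nt : n%:R * t = pi by rewrite /t mulrC divfK ?gt_eqF.
have cos_nt : cos (n%:R * t) = -1 by rewrite nt cospi.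
have sin_nt : sin (n%:R * t) = 0 by rewrite nt sinpi.
have pi0 := pi_gt0 R.
have t0 : 0 < t by rewrite divr_gt0.
have t2 : 2 * t <= pi.
  by rewrite -nt ler_wpM2r ?(ltW t0) // ler_nat.
have cos_lt (s : R) : 0 < s <= pi -> cos s < 1.
  move=> /andP[s0 s1]; have m0 : (0 : R) \in `[0, pi] by rewrite in_itv /= lexx ltW.
  have ms : s \in `[0, pi] by rewrite in_itv /= (ltW s0).
  by rewrite -cos0 ltr_cos.
pose w (c : 'I_n) := mode t ((x0^-1)%g c).
have w1 c : `|w c| <= 1 by rewrite ler_norml mode_bound.
pose phi (i : 'I_n) := mode t i.
have Phi0 : statistic phi w x0 = n%:R / 2.
  have cos_2nt : cos (n%:R * (2 * t)) = 1.
    have -> : n%:R * (2 * t) = pi *+ 2 by rewrite -nt; ring.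
    exact: cos2pi.
  have sin_2nt : sin (n%:R * (2 * t)) = 0.
    have -> : n%:R * (2 * t) = pi *+ 2 by rewrite -nt; ring.
    by rewrite sin_mulr2n sinpi mulr0 mul0rn.
  have sum2 : \sum_(i < n) mode (2 * t) i = 0.
    apply: (sum_mode_eq0 p_gt0 p_lt1 _ _ cos_2nt sin_2nt); first by lia.
    by apply: cos_lt; rewrite t2 mulr_gt0.
  rewrite /statistic; under eq_bigr => i _.
    rewrite /w permK /phi -expr2 mode_sqr mulrDr mulr1; over.
  by rewrite big_split /= -mulr_sumr sum2 mulr0 addr0 sumr_const card_ord -[_ *+ n]mulr_natl.
apply: (@tv_norm_ge R _ _ _ _ _ _ _ (statistic phi w)).
- by move=> s; exact: law_ge0.
- by move=> s; rewrite invr_ge0.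
- exact: sum_law chainX k.
- exact: sum_uniform_law x0.
- by rewrite mulr_gt0 ?exprn_gt0 // divr_gt0.
- rewrite -Phi0; apply: (statistic_variance p_gt0 p_lt1 cos_nt sin_nt chainX) => s.
  by apply: (fluct_sum_variance p_gt0 p_lt1 cos_nt sin_nt) => i.
- apply: uniform_second_moment => // [i|]; first by rewrite ler_norml mode_bound.
  apply: (sum_mode_eq0 p_gt0 p_lt1 _ _ cos_nt sin_nt); first by lia.
  by apply: cos_lt; rewrite t0 /=; lra.
Qed.

End OneDeck.
End Asymptotics.

(** * The lower bound on the mixing time *)

Section MixingTime.
Variables (R : realType) (p : R).
Hypotheses (p_gt0 : 0 < p) (p_lt1 : p < 1).
Let q := 1 - p.

Definition time_constant : R := p ^+ 2 * (2 - p) / (8 * pi ^+ 2 * (1 - p ^+ 2)).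

Definition cut_rate : R := - ln q.

(** With [r <= 3 * ln n / cut_rate + 1] one step of the shuffle adds at most
[variance_constant * (1 + ln n) / n] to the variance; the final 12 bounds the
contribution of distant pairs. *)
Definition variance_constant : R :=
  (12 / cut_rate + 5) * (8 * pi ^+ 2 / p ^+ 2) + 12.

(** The factor 16 is 4 from Chebyshev's inequality times 4 from the square of
[n / 2]; the factor [12 ^+ 3] comes from [expR_quarter_ge], and the summand 2
accounts for the variance under the uniform law. *)
Definition error_constant : R :=
  16 * 12 ^+ 3 * (time_constant * variance_constant + 2).

Lemma cut_rate_gt0 : 0 < cut_rate.
Proof.
rewrite /cut_rate oppr_gt0 ln_lt0 // /q subr_gt0 p_lt1 /=.
by move: p_gt0; lra.
Qed.

Lemma expr_cut_rate m : q ^+ m = expR (- (cut_rate * m%:R)).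
Proof. by rewrite /cut_rate mulNr opprK expRM_natr lnK // posrE subr_gt0. Qed.

Lemma time_constant_gt0 : 0 < time_constant.
Proof.
have p2 : p ^+ 2 < 1 by rewrite exprn_ilt1 // ltW.
rewrite /time_constant divr_gt0 ?mulr_gt0 ?exprn_gt0 ?pi_gt0 //.
  by move: p_lt1; lra.
by rewrite subr_gt0.
Qed.

Lemma variance_constant_gt0 : 0 < variance_constant.
Proof.
rewrite /variance_constant ltr_wpDl // mulr_ge0 //.
  by rewrite addr_ge0 // divr_ge0 // ltW // cut_rate_gt0.
by rewrite divr_ge0 ?sqr_ge0 // mulr_ge0 ?sqr_ge0.
Qed.

Lemma error_constant_gt0 : 0 < error_constant.
Proof.
rewrite /error_constant !mulr_gt0 ?exprn_gt0 // ltr_wpDl // mulr_ge0 //.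
  exact: ltW time_constant_gt0.
exact: ltW variance_constant_gt0.
Qed.

(** One power of [1 + L] more than the square in the variance, which leaves a
quotient of order [1 / (1 + L)]. *)
Lemma expR_quarter_ge (L : R) : 0 <= L -> (1 + L) ^+ 3 / 12 ^+ 3 <= expR (L / 4).
Proof.
move=> L0; have -> : L / 4 = 3%:R * (L / 12) by field.
rewrite expRM_natl; apply: (@le_trans _ _ ((1 + L / 12) ^+ 3)).
  have -> : (1 + L) ^+ 3 / 12 ^+ 3 = ((1 + L) / 12) ^+ 3 by rewrite expr_div_n.
  by rewrite lerXn2r ?nnegrE ?divr_ge0 ?addr_ge0 //; lra.
by rewrite lerXn2r ?nnegrE ?addr_ge0 ?divr_ge0 ?expR_ge0 ?expR_ge1Dx.
Qed.

Lemma near_term_eq (N a c : R) : N != 0 ->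
  N * a * (8 * (c / N) ^+ 2 / p ^+ 2) = a * (8 * c ^+ 2 / p ^+ 2) / N.
Proof. by move=> N0; field; rewrite N0 gt_eqF. Qed.

Variables (n : nat) (d : measure_display) (T : measurableType d).
Variables (P : probability T R) (x0 : 'S_n) (X : nat -> T -> 'S_n).
Hypothesis chainX : markov_chain P (@overhand R p n) x0 X.
Hypothesis n_ge2 : (2 <= n)%N.
Hypothesis n_large : 2 * pi ^+ 2 / p ^+ 2 <= n%:R.
Hypothesis n_large_q : 3 / cut_rate <= n%:R.

Let N : R := n%:R.
Let L : R := ln N.
Let f : R := time_constant * N ^+ 2 * L.
Let k := Num.truncn f.
Let t : R := pi / N.
Let lam := mode_eigenvalue p n t (-1).

Lemma deck_ge2 : 2 <= N.
Proof. by rewrite /N ler_nat. Qed.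

Lemma ln_deck_ge0 : 0 <= L.
Proof. by apply: ln_ge0; have := deck_ge2; lra. Qed.

Lemma expR_ln_deck : expR L = N.
Proof. by rewrite lnK // posrE; have := deck_ge2; lra. Qed.

Lemma time_ge0 : 0 <= f.
Proof.
by rewrite /f mulr_ge0 ?ln_deck_ge0 // mulr_ge0 ?sqr_ge0 // ltW // time_constant_gt0.
Qed.

Lemma time_le : k%:R <= f.
Proof. by rewrite truncn_le time_ge0. Qed.

Let x : R := q * t ^+ 2 / p ^+ 2.

Lemma leading_eigenvalue_ge : expR (- (3 / 2 * x)) <= lam.
Proof.
have [p0 p1] := (p_gt0, p_lt1); have N2 := deck_ge2; have L0 := ln_deck_ge0.
have N0 : N != 0 by lra.
have pN : 0 < N by lra.
have p20 : 0 < p ^+ 2 by rewrite exprn_gt0.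
have x_le : x <= 2 / 3.
  have -> : x = q * (2 * pi ^+ 2 / p ^+ 2 / N) / (2 * N).
    by rewrite /x /t; field; rewrite N0 gt_eqF.
  rewrite ler_pdivrMr; last by lra.
  have y1 : 2 * pi ^+ 2 / p ^+ 2 / N <= 1 by rewrite ler_pdivrMr ?mul1r //; lra.
  have y0 : 0 <= 2 * pi ^+ 2 / p ^+ 2 / N.
    by rewrite (divr_ge0 _ (ltW pN)) // divr_ge0 ?sqr_ge0 // mulr_ge0 ?sqr_ge0.
  have : q * (2 * pi ^+ 2 / p ^+ 2 / N) <= 1 by rewrite mulr_ile1 //; rewrite /q; lra.
  lra.
have qn : q ^+ n <= 1 / 4.
  rewrite expr_cut_rate expRN div1r lef_pV2 ?posrE ?expR_gt0 //.
  have c0 := cut_rate_gt0.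
  have : 3 <= cut_rate * n%:R by rewrite mulrC -ler_pdivrMr.
  by have := expR_ge1Dx (cut_rate * n%:R); lra.
exact: (@first_eigenvalue_ge R p p_gt0 p_lt1 n t x_le qn).
Qed.

(** Up to the chosen time the leading mode loses a factor at most
[n ^ (3 / 8)], hence keeps well above the standard deviation of order
[sqrt n * log n]. *)
Lemma signal_ge : expR (- (3 / 8 * L)) <= lam ^+ k.
Proof.
have [p0 p1] := (p_gt0, p_lt1); have N2 := deck_ge2; have L0 := ln_deck_ge0.
have N0 : N != 0 by lra.
apply: (@le_trans _ _ (expR (- (3 / 2 * x)) ^+ k)); last first.
  by rewrite lerXn2r ?nnegrE ?expR_ge0 // (le_trans _ leading_eigenvalue_ge) ?expR_ge0.
rewrite -expRM_natr ler_expR mulNr lerN2.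
have x0' : 0 <= 3 / 2 * x.
  by rewrite mulr_ge0 // divr_ge0 ?sqr_ge0 // mulr_ge0 ?sqr_ge0 //; rewrite /q; lra.
apply: le_trans (ler_wpM2l x0' time_le) _.
have pi0 : pi != 0 :> R by rewrite gt_eqF ?pi_gt0.
have -> : 3 / 2 * x * f = 3 / 2 * ((2 - p) / (8 * (1 + p))) * L.
  rewrite /x /f /time_constant /t /q; move: (pi : R) pi0 => c c0; field.
  by rewrite c0 N0 !gt_eqF //=; nra.
rewrite ler_wpM2r //.
have : (2 - p) / (8 * (1 + p)) <= 1 / 4 by rewrite ler_pdivrMr; lra.
lra.
Qed.

Lemma shuffle_tv_ge_ln :
  1 - error_constant / (1 + L) <= tv_norm (law P (X k)) (@uniform_law R _).
Proof.
have [p0 p1] := (p_gt0, p_lt1); have N2 := deck_ge2; have L0 := ln_deck_ge0.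
have c0 := cut_rate_gt0.
have y0 : 0 <= 3 * L / cut_rate by rewrite divr_ge0 ?(ltW c0) // mulr_ge0.
(* This choice of r makes q ^+ r at most N ^- 3. *)
have [r r_le r_ge] : exists2 r : nat,
    r%:R <= 3 * L / cut_rate + 1 & 3 * L <= cut_rate * r%:R.
  exists (Num.truncn (3 * L / cut_rate)).+1.
    by rewrite -natr1 lerD2r truncn_le.
  by rewrite [leRHS]mulrC -ler_pdivrMr //; have /andP[_ /ltW] := truncn_itv y0.
have lam0 : 0 < lam by apply: lt_le_trans leading_eigenvalue_ge; exact: expR_gt0.
apply: le_trans (shuffle_tv_ge p_gt0 p_lt1 chainX n_ge2 k r lam0).
rewrite -/N -/t -/lam; set B := N * _ * _ + _.
have pN : 0 < N by lra.
have qr : q ^+ r <= N ^- 3.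
  rewrite expr_cut_rate -expR_ln_deck -expRM_natl -expRN ler_expR lerN2.
  by rewrite -[3%:R]/(3 : R).
have B_le : B <= variance_constant * (1 + L) / N.
  have -> : B = (4 * r%:R + 1) * (8 * pi ^+ 2 / p ^+ 2) / N + 12 * N ^+ 2 * q ^+ r.
    by rewrite /B /t near_term_eq // gt_eqF.
  have tail : 12 * N ^+ 2 * q ^+ r <= 12 / N.
    have -> : 12 / N = 12 * N ^+ 2 * N ^- 3 by field; rewrite gt_eqF.
    by rewrite ler_wpM2l // mulr_ge0 ?sqr_ge0.
  have head : 4 * r%:R + 1 <= (12 / cut_rate + 5) * (1 + L).
    have i0 : 0 <= 12 / cut_rate by rewrite divr_ge0 // ltW.
    have -> : (12 / cut_rate + 5) * (1 + L) =
      4 * (3 * L / cut_rate + 1) + 1 + (12 / cut_rate + 5 * L) by ring.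
    by move: (3 * L / cut_rate) (12 / cut_rate) r_le i0 => u v *; lra.
  set v := 8 * pi ^+ 2 / p ^+ 2.
  have v0 : 0 <= v by rewrite /v divr_ge0 ?sqr_ge0 // mulr_ge0 ?sqr_ge0.
  apply: le_trans (lerD (ler_wpM2r _ (ler_wpM2r v0 head)) tail) _.
    by rewrite invr_ge0 ltW.
  by rewrite -mulrDl ler_wpM2r ?invr_ge0 ?(ltW pN) // /variance_constant -/v; nra.
have B0 : 0 <= B.
  have v0 : 0 <= 8 * t ^+ 2 / p ^+ 2.
    by rewrite divr_ge0 ?sqr_ge0 // mulr_ge0 ?sqr_ge0.
  have qr0 : 0 <= q ^+ r by rewrite exprn_ge0 // ltW // no_cut_gt0.
  have rn0 : 0 <= N * (4 * r%:R + 1).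
    by apply: mulr_ge0; [exact: ltW | rewrite addr_ge0 // mulr_ge0].
  have n20 : 0 <= 12 * N ^+ 2 by rewrite mulr_ge0 ?sqr_ge0.
  exact: addr_ge0 (mulr_ge0 rn0 v0) (mulr_ge0 n20 qr0).
set C := time_constant * variance_constant + 2.
have noise : k%:R * B + 2 * N <= C * (1 + L) ^+ 2 * N.
  have kB : k%:R * B <= f * (variance_constant * (1 + L) / N).
    by rewrite ler_pM ?time_le.
  have -> : C * (1 + L) ^+ 2 * N = time_constant * variance_constant * (1 + L) ^+ 2 * N
     + 2 * (1 + L) ^+ 2 * N by rewrite /C; ring.
  rewrite lerD //; last by rewrite ler_wpM2r ?(ltW pN) //; nra.
  apply: le_trans kB _.
  have -> : f * (variance_constant * (1 + L) / N) =
      time_constant * variance_constant * (L * (1 + L)) * N.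
    by rewrite /f; field; rewrite gt_eqF.
  have tv0 : 0 <= time_constant * variance_constant.
    by rewrite mulr_ge0 // ltW ?time_constant_gt0 ?variance_constant_gt0.
  by rewrite ler_wpM2r ?(ltW pN) // ler_wpM2l //; nra.
have signal : N * ((1 + L) ^+ 3 / 12 ^+ 3) / 4 <= (lam ^+ k * (N / 2)) ^+ 2.
  apply: (@le_trans _ _ ((expR (- (3 / 8 * L)) * (N / 2)) ^+ 2)); last first.
    have N20 : 0 <= N / 2 by rewrite divr_ge0 // ltW.
    apply: lerXn2r; rewrite ?nnegrE.
    - by rewrite mulr_ge0 ?expR_ge0.
    - by rewrite mulr_ge0 // exprn_ge0 // ltW.
    - by rewrite ler_wpM2r // signal_ge.
  rewrite exprMn -expRM_natl.
  have -> : 2%:R * - (3 / 8 * L) = L / 4 + - L by field.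
  rewrite expRD expRN expR_ln_deck.
  have -> : expR (L / 4) / N * (N / 2) ^+ 2 = N * expR (L / 4) / 4.
    by field; rewrite gt_eqF.
  by rewrite ler_wpM2r // ler_wpM2l ?expR_quarter_ge // ltW.
rewrite lerD2l lerN2.
have sig0 : 0 < (lam ^+ k * (N / 2)) ^+ 2.
  by rewrite exprn_gt0 // mulr_gt0 ?exprn_gt0 // divr_gt0.
have C0 : 0 <= C.
  by rewrite addr_ge0 // mulr_ge0 // ltW ?time_constant_gt0 ?variance_constant_gt0.
rewrite ler_pdivrMr //.
have L1 : 0 < 1 + L by rewrite ltr_wpDr.
have E0 : 0 <= error_constant / (1 + L) by rewrite divr_ge0 // ltW // error_constant_gt0.
apply: le_trans (ler_wpM2l E0 signal).
have -> : error_constant / (1 + L) * (N * ((1 + L) ^+ 3 / 12 ^+ 3) / 4) =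
    4 * (C * (1 + L) ^+ 2 * N).
  by rewrite /error_constant -/C; field; rewrite gt_eqF.
by rewrite ler_wpM2l.
Qed.
End MixingTime.

Unset Implicit Arguments.

Theorem theorem3p3 (R : realType) (p : R) (hp0 : 0 < p) (hp1 : p < 1)
    (d : nat -> measure_display) (T : forall n : nat, measurableType (d n))
    (P : forall n : nat, probability (T n) R)
    (x0 : forall n : nat, 'S_n)
    (X : forall n : nat, nat -> T n -> 'S_n)
    (hX : forall n : nat,
       markov_chain (P n) (@overhand R p n) (x0 n) (X n)) :
  let f (n : nat) : R :=
    p ^+ 2 * (2 - p) / (8 * pi ^+ 2 * (1 - p ^+ 2)) * n%:R ^+ 2 * ln n%:R in
  tv_norm (law (P n) (X n (Num.truncn (f n)))) (@uniform_law R _)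
    @[n --> \oo] --> (1 : R).
Proof.
move=> f; apply/cvgrPdist_le => eps eps0.
have E0 := error_constant_gt0 hp0 hp1.
near=> n.
have n2 : (2 <= n)%N by near: n; exact: nbhs_infty_ge.
have tv_le1 : tv_norm (law (P n) (X n (Num.truncn (f n)))) (@uniform_law R _) <= 1.
  apply: tv_norm_le1 => [s|s||].
  - exact: law_ge0.
  - by rewrite invr_ge0.
  - exact: sum_law (hX n) _.
  - exact: sum_uniform_law (x0 n).
have tv_ge : 1 - error_constant p / (1 + ln n%:R) <=
    tv_norm (law (P n) (X n (Num.truncn (f n)))) (@uniform_law R _).
  apply: (shuffle_tv_ge_ln hp0 hp1 (hX n) n2); near: n; exact: nbhs_infty_ger.
have ln_ge : error_constant p / eps <= ln n%:R.
  rewrite -[leLHS]expRK ler_ln ?posrE ?expR_gt0 //; last by rewrite ltr0n; lia.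
  by near: n; exact: nbhs_infty_ger.
have c0 : 0 <= error_constant p / eps by rewrite divr_ge0 // ltW.
rewrite ger0_norm ?subr_ge0 //.
have : error_constant p / (1 + ln n%:R) <= eps.
  rewrite ler_pdivrMr; last by lra.
  rewrite mulrC -ler_pdivrMr //; lra.
by lra.
Unshelve. all: by end_near.
Qed.
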